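(* For all integers $p,q,s\ge 0$ and all $z\in\mathbb{C}$, $$H_{p+s,q}(z,\overline{z})=q!\,s!\sum_{k=0}^{\min(q,s)}\frac{(-1)^k}{k!}\,\frac{z^{s-k}}{(s-k)!}\,\frac{H_{p,q-k}(z,\overline{z})}{(q-k)!}.$$
   Context: For $z=x+iy\in\mathbb{C}$, $\partial_z=\frac12\left(\frac{\partial}{\partial x}-i\frac{\partial}{\partial y}\right)$ and $\partial_{\overline{z}}=\frac12\left(\frac{\partial}{\partial x}+i\frac{\partial}{\partial y}\right)$. The complex Hermite polynomials are, for integers $p,q\ge 0$, $$H_{p,q}(z,\overline{z})=(-1)^{p+q}e^{z\overline{z}}\,\partial_{\overline{z}}^{p}\partial_z^{q}\left(e^{-z\overline{z}}\right).$$ *)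

(* Defs.v *)
From Stdlib Require Import Reals Factorial.
From Coquelicot Require Import Coquelicot.

Local Open Scope C_scope.

Definition Cexp (z : C) : C :=
  ((exp (Re z) * cos (Im z))%R, (exp (Re z) * sin (Im z))%R).

(* Partial derivatives with respect to the real coordinates x and y of
   z = x + i y.  Coquelicot's [Derive] is total and real-valued, hence the
   componentwise definition; it is only meaningful where the real and imaginary
   parts are differentiable, which is the case for all derivatives of
   exp (- z * conj z). *)
Definition partial_x (f : C -> C) (z : C) : C :=
  (Derive (fun t : R => Re (f (t, Im z))) (Re z),
   Derive (fun t : R => Im (f (t, Im z))) (Re z)).

Definition partial_y (f : C -> C) (z : C) : C :=
  (Derive (fun t : R => Re (f (Re z, t))) (Im z),
   Derive (fun t : R => Im (f (Re z, t))) (Im z)).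

Definition partial_z (f : C -> C) (z : C) : C :=
  / 2 * (partial_x f z - Ci * partial_y f z).

Definition partial_zbar (f : C -> C) (z : C) : C :=
  / 2 * (partial_x f z + Ci * partial_y f z).

(* H_{p,q} as a function of z; [partial_z] is applied first, q times. *)
Definition complex_hermite (p q : nat) (z : C) : C :=
  (- 1) ^ (p + q) * Cexp (z * Cconj z) *
  Nat.iter p partial_zbar
    (Nat.iter q partial_z (fun w : C => Cexp (- (w * Cconj w)))) z.

Definition Cfact (n : nat) : C := RtoC (INR (fact n)).

(* Main.v *)
Require Import Defs.
From Stdlib Require Import Reals Factorial Lra Lia FunctionalExtensionality.
From Coquelicot Require Import Coquelicot.

Local Open Scope C_scope.

(** Since [partial_z^q e^(-|z|^2) = (-zbar)^q e^(-|z|^2)], one gets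
    [H_{p,q} = hermite_rec p q], where [hermite_rec 0 q = zbar^q] and
    [hermite_rec (p+1) q = z hermite_rec p q - q hermite_rec p (q-1)]; the second
    clause is the Leibniz rule together with
    [partial_zbar hermite_rec p q = q hermite_rec p (q-1)].  The operator in the
    index [q] on the right is a sum of two commuting operators, multiplication
    by [z] and [f |-> - q f (q-1)], so its [s]-th power is given by the binomial
    theorem. *)

(** * Wirtinger calculus through componentwise real derivatives *)

Definition is_derive_C (g : R -> C) (t : R) (l : C) : Prop :=
  is_derive (fun u => Re (g u)) t (Re l) /\
  is_derive (fun u => Im (g u)) t (Im l).

Lemma is_derive_C_plus (f g : R -> C) (t : R) (l m : C) :
  is_derive_C f t l -> is_derive_C g t m ->
  is_derive_C (fun u => f u + g u) t (l + m).
Proof.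
  intros [Hf1 Hf2] [Hg1 Hg2]; split.
  - exact (is_derive_plus _ _ _ _ _ Hf1 Hg1).
  - exact (is_derive_plus _ _ _ _ _ Hf2 Hg2).
Qed.

Lemma is_derive_C_mult (f g : R -> C) (t : R) (l m : C) :
  is_derive_C f t l -> is_derive_C g t m ->
  is_derive_C (fun u => f u * g u) t (l * g t + f t * m).
Proof.
  intros [Hf1 Hf2] [Hg1 Hg2].
  assert (M : forall (a b : R -> R) (a' b' : R),
    is_derive a t a' -> is_derive b t b' ->
    is_derive (fun u => (a u * b u)%R) t (a' * b t + a t * b')%R).
  { intros a b a' b' Ha Hb.
    exact (is_derive_mult a b t a' b' Ha Hb Rmult_comm). }
  split.
  - evar_last.
    + exact (is_derive_minus _ _ _ _ _ (M _ _ _ _ Hf1 Hg1) (M _ _ _ _ Hf2 Hg2)).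
    + unfold minus, plus, opp, Re, Im; simpl; ring.
  - evar_last.
    + exact (is_derive_plus _ _ _ _ _ (M _ _ _ _ Hf1 Hg2) (M _ _ _ _ Hf2 Hg1)).
    + unfold plus, Re, Im; simpl; ring.
Qed.

(* [a] and [b] are the derivatives of [f] in z and zbar, so that
   [f_x = a + b] and [f_y = i (a - b)]. *)
Definition is_wirtinger (f a b : C -> C) : Prop :=
  forall z : C,
    is_derive_C (fun t => f (t, Im z)) (Re z) (a z + b z) /\
    is_derive_C (fun t => f (Re z, t)) (Im z) (Ci * (a z - b z)).

Lemma is_wirtinger_ext (f f' a a' b b' : C -> C) :
  (forall z, f z = f' z) -> (forall z, a z = a' z) -> (forall z, b z = b' z) ->
  is_wirtinger f a b -> is_wirtinger f' a' b'.
Proof.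
  intros Hf Ha Hb.
  rewrite (functional_extensionality _ _ Hf),
    (functional_extensionality _ _ Ha), (functional_extensionality _ _ Hb).
  tauto.
Qed.

Lemma is_wirtinger_partial_x (f a b : C -> C) (z : C) :
  is_wirtinger f a b -> partial_x f z = a z + b z.
Proof.
  intros H; destruct (H z) as [[H1 H2] _]; unfold partial_x.
  apply injective_projections; apply is_derive_unique; assumption.
Qed.

Lemma is_wirtinger_partial_y (f a b : C -> C) (z : C) :
  is_wirtinger f a b -> partial_y f z = Ci * (a z - b z).
Proof.
  intros H; destruct (H z) as [_ [H1 H2]]; unfold partial_y.
  apply injective_projections; apply is_derive_unique; assumption.
Qed.

Lemma Ci_mul_Ci_mul (w : C) : Ci * (Ci * w) = - w.
Proof. unfold Ci; destruct w; apply injective_projections; simpl; ring. Qed.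

Lemma C2_neq_0 : 2 <> 0 :> C.
Proof. intros H; apply (f_equal Re) in H; simpl in H; lra. Qed.

(** Here [i f_y = -(a - b)], so half of [f_x - i f_y] is [a]. The equality is between functions, so
    that it can rewrite each stage of an iterated derivative. *)
Lemma is_wirtinger_partial_z (f a b : C -> C) :
  is_wirtinger f a b -> partial_z f = a.
Proof.
  intros H; apply functional_extensionality; intros z; unfold partial_z.
  rewrite (is_wirtinger_partial_x f a b z H), (is_wirtinger_partial_y f a b z H).
  rewrite Ci_mul_Ci_mul; field; exact C2_neq_0.
Qed.

Lemma is_wirtinger_partial_zbar (f a b : C -> C) :
  is_wirtinger f a b -> partial_zbar f = b.
Proof.
  intros H; apply functional_extensionality; intros z; unfold partial_zbar.
  rewrite (is_wirtinger_partial_x f a b z H), (is_wirtinger_partial_y f a b z H).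
  rewrite Ci_mul_Ci_mul; field; exact C2_neq_0.
Qed.

Lemma is_wirtinger_plus (f g a b a' b' : C -> C) :
  is_wirtinger f a b -> is_wirtinger g a' b' ->
  is_wirtinger (fun z => f z + g z) (fun z => a z + a' z) (fun z => b z + b' z).
Proof.
  intros Hf Hg z; destruct (Hf z) as [Hf1 Hf2]; destruct (Hg z) as [Hg1 Hg2].
  split.
  - replace (a z + a' z + (b z + b' z)) with (a z + b z + (a' z + b' z)) by ring.
    exact (is_derive_C_plus _ _ _ _ _ Hf1 Hg1).
  - replace (Ci * (a z + a' z - (b z + b' z)))
      with (Ci * (a z - b z) + Ci * (a' z - b' z)) by ring.
    exact (is_derive_C_plus _ _ _ _ _ Hf2 Hg2).
Qed.

Lemma is_wirtinger_mult (f g a b a' b' : C -> C) :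
  is_wirtinger f a b -> is_wirtinger g a' b' ->
  is_wirtinger (fun z => f z * g z)
    (fun z => a z * g z + f z * a' z) (fun z => b z * g z + f z * b' z).
Proof.
  intros Hf Hg z; destruct (Hf z) as [Hf1 Hf2]; destruct (Hg z) as [Hg1 Hg2].
  generalize (is_derive_C_mult _ _ _ _ _ Hf1 Hg1)
    (is_derive_C_mult _ _ _ _ _ Hf2 Hg2).
  replace (Re z, Im z) with z by apply surjective_pairing.
  intros H1 H2; split.
  - replace (a z * g z + f z * a' z + (b z * g z + f z * b' z))
      with ((a z + b z) * g z + f z * (a' z + b' z)) by ring.
    exact H1.
  - replace (Ci * (a z * g z + f z * a' z - (b z * g z + f z * b' z)))
      with (Ci * (a z - b z) * g z + f z * (Ci * (a' z - b' z))) by ring.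
    exact H2.
Qed.

Lemma is_wirtinger_const (c : C) :
  is_wirtinger (fun _ => c) (fun _ => 0) (fun _ => 0).
Proof.
  intros [x y]; split; split; unfold Re, Im; simpl; auto_derive; trivial; ring.
Qed.

Lemma is_wirtinger_id :
  is_wirtinger (fun z => z) (fun _ => 1) (fun _ => 0).
Proof.
  intros [x y]; split; split; unfold Re, Im; simpl; auto_derive; trivial; ring.
Qed.

Lemma is_wirtinger_Cconj :
  is_wirtinger Cconj (fun _ => 0) (fun _ => 1).
Proof.
  intros [x y]; split; split; unfold Re, Im; simpl; auto_derive; trivial; ring.
Qed.

Lemma is_wirtinger_Cconj_pow (q : nat) :
  is_wirtinger (fun z => Cconj z ^ q) (fun _ => 0)
    (fun z => RtoC (INR q) * Cconj z ^ (q - 1)).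
Proof.
  induction q as [|q IH].
  - eapply is_wirtinger_ext; [| | |apply (is_wirtinger_const 1)]; intros z; simpl; ring.
  - eapply is_wirtinger_ext;
      [| | |exact (is_wirtinger_mult _ _ _ _ _ _ is_wirtinger_Cconj IH)]; intros z.
    + reflexivity.
    + simpl; ring.
    (* The product rule gives [Cconj z ^ q + Cconj z * (q * Cconj z ^ (q - 1))]. The powers merge
       only for positive [q], since [q - 1] is truncated. *)
    + destruct q as [|q]; [simpl; ring|].
      rewrite (S_INR (S q)), RtoC_plus.
      replace (S (S q) - 1)%nat with (S q) by lia.
      replace (S q - 1)%nat with q by lia.
      simpl Cpow; ring.
Qed.

(** * The Gaussian and its iterated derivatives *)

Definition gauss (z : C) : C := Cexp (- (z * Cconj z)).

Lemma gauss_real (z : C) : gauss z = RtoC (exp (- (Re z * Re z + Im z * Im z))).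
Proof.
  destruct z as [x y]; unfold gauss, Cexp, RtoC; simpl.
  replace (- (x * - y + y * x))%R with 0%R by ring.
  rewrite cos_0, sin_0.
  replace (- (x * x - y * - y))%R with (- (x * x + y * y))%R by ring.
  apply injective_projections; simpl; ring.
Qed.

Lemma Cexp_mul_gauss (z : C) : Cexp (z * Cconj z) * gauss z = 1.
Proof.
  rewrite gauss_real; destruct z as [x y]; unfold Cexp, RtoC; simpl.
  replace (x * - y + y * x)%R with 0%R by ring.
  rewrite cos_0, sin_0, exp_Ropp.
  replace (x * x - y * - y)%R with (x * x + y * y)%R by ring.
  assert (exp (x * x + y * y) <> 0)%R by apply Rgt_not_eq, exp_pos.
  apply injective_projections; simpl; field; assumption.
Qed.

Lemma is_wirtinger_gauss :
  is_wirtinger gauss (fun z => - Cconj z * gauss z) (fun z => - z * gauss z).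
Proof.
  (* With the Gaussian written as a real exponential, only real functions within reach of
     [auto_derive] remain. *)
  apply (is_wirtinger_ext
    (fun z => RtoC (exp (- (Re z * Re z + Im z * Im z)))) _
    (fun z => - Cconj z * RtoC (exp (- (Re z * Re z + Im z * Im z)))) _
    (fun z => - z * RtoC (exp (- (Re z * Re z + Im z * Im z)))) _);
    try (intros z; rewrite gauss_real; reflexivity).
  intros [x y]; split; split; unfold Re, Im; simpl; auto_derive; trivial; ring.
Qed.

(** Powers of [Cconj z] have zero derivative in z, so each [partial_z] only brings down a factor
    [- Cconj z] from the Gaussian. *)
Lemma iter_partial_z_gauss (q : nat) :
  Nat.iter q partial_z gauss = (fun z => (- 1) ^ q * Cconj z ^ q * gauss z).
Proof.
  induction q as [|q IH].
  - apply functional_extensionality; intros z; simpl; ring.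
  - simpl Nat.iter; rewrite IH.
    rewrite (is_wirtinger_partial_z _ _ _
      (is_wirtinger_mult _ _ _ _ _ _
        (is_wirtinger_mult _ _ _ _ _ _
          (is_wirtinger_const ((- 1) ^ q)) (is_wirtinger_Cconj_pow q))
        is_wirtinger_gauss)).
    apply functional_extensionality; intros z; simpl; ring.
Qed.

(* At [q = 0] the truncated [q - 1] is harmless: the coefficient vanishes. *)
Fixpoint hermite_rec (p q : nat) (z : C) : C :=
  match p with
  | O => Cconj z ^ q
  | S p' => z * hermite_rec p' q z - RtoC (INR q) * hermite_rec p' (q - 1) z
  end.

(** The factor [z] is constant for the zbar-derivative, so the derivative of the recursion is
    [q (z h p (q-1) - (q-1) h p (q-2))], with [h] for [hermite_rec]; this is [q h (p+1) (q-1)]. The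
    z-derivative stays existential: the zbar-iteration below asks only that it exist. *)
Lemma is_wirtinger_hermite_rec (p q : nat) :
  exists a : C -> C,
    is_wirtinger (hermite_rec p q) a
      (fun z => RtoC (INR q) * hermite_rec p (q - 1) z).
Proof.
  revert q; induction p as [|p IH]; intros q.
  - eexists; exact (is_wirtinger_Cconj_pow q).
  - destruct (IH q) as [a Ha]; destruct (IH (q - 1)%nat) as [b Hb].
    eexists; eapply is_wirtinger_ext;
      [| | |exact (is_wirtinger_plus _ _ _ _ _ _
        (is_wirtinger_mult _ _ _ _ _ _ is_wirtinger_id Ha)
        (is_wirtinger_mult _ _ _ _ _ _
          (is_wirtinger_const (- RtoC (INR q))) Hb))]; intros z.
    + simpl; ring.
    + reflexivity.
    + simpl; ring.
Qed.

(** By Leibniz, differentiating [hermite_rec p q * gauss] in zbar gives [(q hermite_rec p (q-1) - z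
    hermite_rec p q) gauss], which is [- hermite_rec (p+1) q * gauss]; the minus sign extends the
    power of [- 1]. *)
Lemma iter_partial_zbar_gauss (p q : nat) :
  Nat.iter p partial_zbar (fun z => (- 1) ^ q * Cconj z ^ q * gauss z) =
  (fun z => (- 1) ^ (p + q) * hermite_rec p q z * gauss z).
Proof.
  induction p as [|p IH]; [reflexivity|].
  simpl Nat.iter; rewrite IH.
  destruct (is_wirtinger_hermite_rec p q) as [a Ha].
  rewrite (is_wirtinger_partial_zbar _ _ _
    (is_wirtinger_mult _ _ _ _ _ _
      (is_wirtinger_mult _ _ _ _ _ _
        (is_wirtinger_const ((- 1) ^ (p + q))) Ha)
      is_wirtinger_gauss)).
  apply functional_extensionality; intros z; simpl; ring.
Qed.

Lemma Cpow_opp1_sqr (n : nat) : (- 1) ^ n * (- 1) ^ n = 1 :> C.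
Proof. induction n as [|n IH]; simpl; [ring|]. rewrite <- IH; ring. Qed.

Lemma complex_hermite_rec (p q : nat) (z : C) :
  complex_hermite p q z = hermite_rec p q z.
Proof.
  unfold complex_hermite; fold gauss.
  rewrite iter_partial_z_gauss, iter_partial_zbar_gauss.
  transitivity ((- 1) ^ (p + q) * (- 1) ^ (p + q) *
    (Cexp (z * Cconj z) * gauss z) * hermite_rec p q z); [ring|].
  rewrite Cpow_opp1_sqr, Cexp_mul_gauss; ring.
Qed.

(** * Finite complex sums and Pascal's rule *)

(** Fixing the monoid lets the sum rules be stated with the operations of [C] that [ring]
    recognises. *)
Definition Csum (a : nat -> C) (n : nat) : C := @sum_n C_AbelianMonoid a n.

Lemma Csum_ext_loc (a b : nat -> C) (n : nat) :
  (forall k, (k <= n)%nat -> a k = b k) -> Csum a n = Csum b n.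
Proof. exact (@sum_n_ext_loc C_AbelianMonoid a b n). Qed.

Lemma Csum_O (a : nat -> C) : Csum a O = a O.
Proof. exact (@sum_O C_AbelianMonoid a). Qed.

Lemma Csum_mult_l (c : C) (a : nat -> C) (n : nat) :
  Csum (fun k => c * a k) n = c * Csum a n.
Proof. exact (@sum_n_mult_l C_Ring c a n). Qed.

Lemma Csum_plus (a b : nat -> C) (n : nat) :
  Csum (fun k => a k + b k) n = Csum a n + Csum b n.
Proof. exact (@sum_n_plus C_AbelianMonoid a b n). Qed.

Lemma Csum_S (a : nat -> C) (n : nat) : Csum a (S n) = Csum a n + a (S n).
Proof. exact (@sum_Sn C_AbelianMonoid a n). Qed.

Lemma Csum_S_l (a : nat -> C) (n : nat) :
  Csum a (S n) = a O + Csum (fun k => a (S k)) n.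
Proof.
  induction n as [|n IH].
  - rewrite Csum_S; now rewrite !Csum_O.
  - rewrite Csum_S, IH, Csum_S; ring.
Qed.

Definition Cbinom (n k : nat) : C := RtoC (Binomial.C n k).

Lemma Cbinom_0 (n : nat) : Cbinom n 0 = 1.
Proof.
  unfold Cbinom, Binomial.C; f_equal; rewrite Nat.sub_0_r; simpl.
  field; apply INR_fact_neq_0.
Qed.

Lemma Cbinom_diag (n : nat) : Cbinom n n = 1.
Proof.
  unfold Cbinom, Binomial.C; f_equal; rewrite Nat.sub_diag; simpl.
  field; apply INR_fact_neq_0.
Qed.

(** Pascal's rule summed against [a]. [Binomial.C n k] is a quotient of factorials with truncated
    [n - k], hence nonzero for [k > n]; the end terms are therefore split off and Pascal is used
    only in the interior. *)
Lemma Csum_Cbinom_S (a : nat -> C) (n : nat) :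
  Csum (fun k => Cbinom (S n) k * a k) (S n) =
  Csum (fun k => Cbinom n k * a k) n + Csum (fun k => Cbinom n k * a (S k)) n.
Proof.
  destruct n as [|n].
  - rewrite Csum_S, !Csum_O, !Cbinom_0, Cbinom_diag; ring.
  - rewrite Csum_S, Csum_S_l, (Csum_S_l (fun k => Cbinom (S n) k * a k)),
      (Csum_S (fun k => Cbinom (S n) k * a (S k))), !Cbinom_0, !Cbinom_diag.
    rewrite (Csum_ext_loc _ (fun k => Cbinom (S n) k * a (S k) +
      Cbinom (S n) (S k) * a (S k))).
    + rewrite Csum_plus; ring.
    + intros k Hk; unfold Cbinom.
      rewrite <- pascal, RtoC_plus by lia; ring.
Qed.

(** * The binomial theorem for the index shift *)

(** The falling factorial [q (q-1) ... (q-k+1)], the coefficient left by [k] applications of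
    [f |-> q f (q-1)]. *)
Fixpoint falling (q k : nat) : nat :=
  match k with
  | O => 1
  | S k' => q * falling (q - 1) k'
  end.

Lemma falling_fact (q k : nat) :
  (k <= q)%nat -> (falling q k * fact (q - k) = fact q)%nat.
Proof.
  revert q; induction k as [|k IH]; intros q Hk; simpl.
  - rewrite Nat.sub_0_r; lia.
  - destruct q as [|q]; [lia|].
    specialize (IH q ltac:(lia)); simpl Nat.sub in *.
    rewrite Nat.sub_0_r, <- Nat.mul_assoc, IH; reflexivity.
Qed.

Lemma falling_small (q k : nat) : (q < k)%nat -> falling q k = O.
Proof.
  revert q; induction k as [|k IH]; intros q Hk; [lia|simpl].
  destruct q as [|q]; [reflexivity|]; rewrite IH; lia.
Qed.

Lemma binomial_shift (f : nat -> nat -> C) (z : C) (p s : nat) :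
  (forall p q, f (S p) q = z * f p q - RtoC (INR q) * f p (q - 1)%nat) ->
  forall q, f (p + s)%nat q =
    Csum (fun k => Cbinom s k *
      ((- 1) ^ k * RtoC (INR (falling q k)) * z ^ (s - k) * f p (q - k)%nat)) s.
Proof.
  intros Hf; induction s as [|s IH]; intros q.
  - rewrite Csum_O, Cbinom_0, Nat.add_0_r, !Nat.sub_0_r; simpl; ring.
  - rewrite Nat.add_succ_r, Hf, !IH, Csum_Cbinom_S.
    (* Of the two Pascal halves, the unshifted one absorbs the factor [z], and the shifted one
       absorbs [- q] together with the induction hypothesis at [q - 1]. *)
    unfold Cminus; f_equal.
    + rewrite <- Csum_mult_l; apply Csum_ext_loc; intros k Hk.
      replace (S s - k)%nat with (S (s - k)) by lia; simpl; ring.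
    + transitivity (- RtoC (INR q) * Csum (fun k => Cbinom s k *
        ((- 1) ^ k * RtoC (INR (falling (q - 1) k)) * z ^ (s - k) *
          f p (q - 1 - k)%nat)) s); [ring|].
      rewrite <- Csum_mult_l.
      apply Csum_ext_loc; intros k _.
      replace (q - 1 - k)%nat with (q - S k)%nat by lia.
      simpl falling; rewrite mult_INR, RtoC_mult.
      simpl; ring.
Qed.

Lemma Csum_truncate (a : nat -> C) (m n : nat) :
  (m <= n)%nat -> (forall k, (m < k <= n)%nat -> a k = 0) ->
  Csum a n = Csum a m.
Proof.
  intros Hmn Ha; induction Hmn as [|n Hmn IH]; [reflexivity|].
  rewrite Csum_S, IH, Ha; [ring|lia|].
  intros k Hk; apply Ha; lia.
Qed.

Lemma Cfact_neq_0 (n : nat) : Cfact n <> 0.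
Proof. intros H; apply (INR_fact_neq_0 n), RtoC_inj, H. Qed.

Theorem mainTheorem8 (p q s : nat) (z : C) :
  complex_hermite (p + s) q z =
  Cfact q * Cfact s *
  @sum_n C_AbelianMonoid
    (fun k : nat =>
       (- 1) ^ k / Cfact k *
       (z ^ (s - k) / Cfact (s - k)) *
       (complex_hermite p (q - k) z / Cfact (q - k)))
    (Nat.min q s).
Proof.
  change (@sum_n C_AbelianMonoid) with Csum.
  rewrite complex_hermite_rec.
  rewrite (binomial_shift (fun p q => hermite_rec p q z) z p s) by reflexivity.
  (* The expansion runs up to [s], but terms beyond [Nat.min q s] have [k > q], where [falling q k]
     contains the factor 0. *)
  rewrite <- Csum_mult_l, (Csum_truncate _ (Nat.min q s) s).
  - apply Csum_ext_loc; intros k Hk.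
    rewrite complex_hermite_rec.
    (* Since [k <= q], the quotient [q! / (q-k)!] of the statement is [falling q k]. *)
    assert (Hq : Cfact q = RtoC (INR (falling q k)) * Cfact (q - k)).
    { unfold Cfact; rewrite <- RtoC_mult, <- mult_INR, falling_fact by lia.
      reflexivity. }
    assert (Hb : Cbinom s k = Cfact s / (Cfact k * Cfact (s - k))).
    { unfold Cbinom, Binomial.C, Cfact.
      rewrite RtoC_div, RtoC_mult; [reflexivity|].
      apply Rmult_integral_contrapositive_currified; apply INR_fact_neq_0. }
    rewrite Hq, Hb.
    field; repeat split; apply Cfact_neq_0.
  - lia.
  - intros k Hk; rewrite falling_small by lia; simpl; ring.
Qed.
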